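(* Let $F$ be a forest of order $n$ with no isolated vertex. Then the number $\sharp\gamma_t(F)$ of minimum total dominating sets of $F$ satisfies $$\sharp\gamma_t(F)\leq 1.4865^n.$$
   Context: Graphs are finite, simple, undirected, and have at least one vertex; the order of a graph is its number of vertices; a forest is an acyclic graph. A set $D$ of vertices of a graph $G$ is a total dominating set of $G$ if every vertex of $G$ (including those in $D$) has a neighbor in $D$. The total domination number $\gamma_t(G)$ is the minimum cardinality of a total dominating set of $G$ (one exists when $G$ has no isolated vertex). A minimum total dominating set is a total dominating set of cardinality $\gamma_t(G)$, and $\sharp\gamma_t(G)$ denotes the number of minimum total dominating sets of $G$. The constant $1.4865$ is the exact decimal number. *)

(* Defs.v *)
(* MathComp world. A finite simple graph is a symmetric irreflexive adjacency
   relation on a finType, whose elements are the vertices. *)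
From mathcomp Require Import all_boot all_order all_algebra.

Set Implicit Arguments.
Unset Strict Implicit.
Unset Printing Implicit Defensive.

Section Graph.

Variables (V : finType) (e : rel V).

Definition simple_graph : Prop := symmetric e /\ irreflexive e.

(* In a simple graph, the duplicate-free closed e-walks of length at most 2 are
   the empty sequence and the edges traversed back and forth; the longer ones
   are exactly the graph-theoretic cycles. *)
Definition acyclic : Prop := forall s : seq V, ucycle e s -> size s <= 2.

Definition forest : Prop := simple_graph /\ acyclic.

Definition no_isolated_vertex : Prop := forall x : V, exists y : V, e x y.

Definition total_dominating (D : {set V}) : bool :=
  [forall x, exists y in D, e x y].

(* The default [set: V] is itself total dominating when no vertex is isolated,
   see total_dominatingT; otherwise the value is irrelevant. *)
Definition total_domination_number : nat :=
  #|[arg min_(D < [set: V] | total_dominating D) #|D| ]|.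

Definition min_total_dominating (D : {set V}) : bool :=
  total_dominating D && (#|D| == total_domination_number).

Definition num_min_total_dominating : nat :=
  #|[set D : {set V} | min_total_dominating D]|.

Lemma total_dominatingT : no_isolated_vertex -> total_dominating [set: V].
Proof.
move=> h; apply/forallP => x; have [y exy] := h x.
by apply/existsP; exists y; rewrite inE.
Qed.

Lemma total_domination_numberP : no_isolated_vertex ->
  (exists2 D, total_dominating D & #|D| = total_domination_number) /\
  (forall D, total_dominating D -> total_domination_number <= #|D|).
Proof.
move=> h; rewrite /total_domination_number.
case: arg_minnP => [|D tD minD]; first exact: total_dominatingT.
by split; first exists D.
Qed.

End Graph.

(* Main.v *)
Require Import Defs.
From mathcomp Require Import all_boot all_order all_algebra.
From mathcomp Require Import zify lra.

(** A total dominating set of a graph is a transversal of the hypergraph of open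
    neighbourhoods, and a minimum one is a minimal transversal.  For a forest of
    order n this hypergraph has at most 3^(n/3) minimal transversals, a bound
    below 1.4865^n since 3 < 1.4865^3.

    Peeling off leaves orders the vertices of a forest so that each vertex has at
    most one neighbour ranked no lower than itself ([forest_ranking]).  Suppose
    that elements from A have to dominate the vertices of B, and let N be the set
    of elements of A adjacent to the lowest-ranked vertex b of B.  An element of
    N ranked below b has no neighbour in B except b, and at most one element of N
    is not ranked below b.  Hence two elements of a minimal transversal T cannot
    both lie in N: one of them would dominate b only, and b would be dominated by
    the other one anyway.  So T meets N in a single element a, and the rest of T
    is a minimal transversal, with elements from A \ N, for the vertices of B not
    adjacent to a ([card_minimal_transversals_le_sum]).

    With d = #|N| there are d choices of a, and d <= 3^(d/3) with equality only
    at d = 3; the d elements of N that are used up pay for the branching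
    ([card_minimal_transversals]). *)

Section ForestRanking.

Variables (V : finType) (e : rel V).
Hypothesis forest_e : forest e.

(** If every vertex of S had two neighbours in S, a path inside S could always
    be prolonged at its first vertex x by a neighbour other than the second
    vertex; falling back on the path would close a cycle. *)
Lemma forest_leaf (S : {set V}) :
  S != set0 -> exists2 x, x \in S & #|[set y in S | e x y]| <= 1.
Proof.
have [[sym_e irr_e] acyc_e] := forest_e.
case/set0Pn=> s sS; apply/exists_inP; apply/contraT.
rewrite negb_exists_in => /forall_inP noleaf.
have long_path k : exists x p,
    [/\ uniq (x :: p), path e x p, {subset x :: p <= S} & size p = k].
  elim: k => [|k [x [p [Up Pp Sp <-]]]].
    by exists s, [::]; split=> // y; rewrite inE => /eqP->.
  have := noleaf x (Sp x (mem_head x p)); rewrite -ltnNge => /card_gt1P.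
  case=> y1 [y2 []]; rewrite !inE => /andP[y1S xy1] /andP[y2S xy2] ne_y12.
  have [y [yS xy yNhead]] : exists y, [/\ y \in S, e x y & y != head x p].
    have [y1head|] := eqVneq y1 (head x p); last by exists y1.
    by exists y2; split=> //; rewrite -y1head eq_sym.
  have yNx : y != x by apply: contraL xy => /eqP->; rewrite irr_e.
  exists y, (x :: p); split=> //.
  - rewrite cons_uniq Up andbT inE negb_or yNx /=.
    apply/negP => yp; case/splitPr: yp Up Pp yNhead => p1 p2 Up.
    rewrite cat_path /= => /and3P[Pp1 p1y _] yNhead.
    have: size (x :: rcons p1 y) <= 2.
      apply: acyc_e; apply/andP; split.
        by rewrite /= !rcons_path last_rcons Pp1 p1y sym_e xy.
      by move: Up; rewrite -cat_rcons -cat_cons cat_uniq => /andP[].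
    by case: p1 yNhead {Up Pp1 p1y} => [|? ?]; rewrite /= ?eqxx ?size_rcons.
  - by rewrite /= sym_e xy.
  - by move=> z; rewrite inE => /predU1P[->|/Sp].
have [x [p [Up _ _ szp]]] := long_path #|V|.
by have := max_card (mem (x :: p)); rewrite (card_uniqP Up) /= szp ltnn.
Qed.

(** Each leaf in turn is ranked below all the vertices left when it is removed.
    Working with a ranking lets the elements and the vertices to be dominated be
    deleted independently later on, with no induction on the forest itself. *)
Lemma forest_ranking : exists r : V -> nat, forall x y z,
  e x y -> e x z -> r x <= r y -> r x <= r z -> y = z.
Proof.
suff [r rP] : exists r : V -> nat, {in [set: V] & &, forall x y z,
    e x y -> e x z -> r x <= r y -> r x <= r z -> y = z}.
  by exists r => x y z; apply: rP.
move: {2}#|_| (leqnn #|[set: V]|) => n.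
elim: n [set: V] => [|n IHn] S.
  rewrite leqn0 cards_eq0 => /eqP->.
  by exists (fun=> 0) => x y z; rewrite inE.
have [-> _|Sn0 leSn] := eqVneq S set0.
  by exists (fun=> 0) => x y z; rewrite inE.
have [x0 x0S /card_le1_eqP leaf_x0] := forest_leaf S Sn0.
have [|r rP] := IHn (S :\ x0); first by rewrite (cardsD1 x0) x0S in leSn.
exists (fun x => if x == x0 then 0 else (r x).+1) => x y z xS yS zS exy exz.
have [x_x0 _ _|xNx0] := eqVneq x x0.
  by apply: leaf_x0; rewrite inE ?yS ?zS -x_x0.
case: (eqVneq y x0) => // yNx0; case: (eqVneq z x0) => // zNx0.
by rewrite !ltnS; apply: rP; rewrite // !inE ?xNx0 ?yNx0 ?zNx0.
Qed.

End ForestRanking.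

Section MinimalTransversals.

Variables (V : finType) (e : rel V).

(** Minimality is expressed by private neighbours: each t in T is the only
    element of T dominating some vertex of B.  The sets A and B may overlap: as a
    vertex that dominates and as a vertex to be dominated, a vertex of the forest
    plays two independent roles. *)
Definition minimal_transversal (A B T : {set V}) : bool :=
  [&& T \subset A,
      [forall b in B, exists t in T, e b t] &
      [forall t in T, exists b in B, e b t && [forall s in T, e b s ==> (s == t)]]].

Lemma minimal_transversalP (A B T : {set V}) :
  reflect [/\ T \subset A,
              forall b, b \in B -> exists2 t, t \in T & e b t &
              forall t, t \in T -> exists b,
                [/\ b \in B, e b t & forall s, s \in T -> e b s -> s = t]]
          (minimal_transversal A B T).
Proof.
apply: (iffP and3P) => [[TA dom priv]|[TA dom priv]]; split=> //.
- by move=> b bB; have /exists_inP := forall_inP dom b bB.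
- move=> t tT; have /exists_inP[b bB /andP[bt /forall_inP tb]] := forall_inP priv t tT.
  by exists b; split=> // s sT bs; apply/eqP/(implyP (tb s sT)).
- by apply/forall_inP => b bB; apply/exists_inP; apply: dom.
- apply/forall_inP => t /priv[b [bB bt tb]]; apply/exists_inP; exists b => //.
  by rewrite bt; apply/forall_inP => s sT; apply/implyP => bs; rewrite (tb s).
Qed.

Definition minimal_transversals (A B : {set V}) : {set {set V}} :=
  [set T | minimal_transversal A B T].

(** The private neighbours of the elements other than a are not adjacent to a,
    so they survive the removal of a together with all that it dominates. *)
Lemma minimal_transversalD1 (A B N T : {set V}) (a : V) :
    minimal_transversal A B T -> T :&: N = [set a] ->
  minimal_transversal (A :\: N) (B :\: [set b | e b a]) (T :\ a).
Proof.
case/minimal_transversalP => TA dom priv TN.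
have /setIP[aT aN] : a \in T :&: N by rewrite TN set11.
apply/minimal_transversalP; split.
- apply/subsetP => t /setD1P[tNa tT]; rewrite inE (subsetP TA) // andbT.
  by apply: contra tNa => tN; rewrite -in_set1 -TN inE tT.
- move=> b /setDP[bB]; rewrite inE => bNa; have [t tT bt] := dom b bB.
  by exists t => //; rewrite !inE tT andbT; apply: contraNneq bNa => <-.
- move=> t /setD1P[tNa tT]; have [b [bB bt tb]] := priv t tT.
  exists b; split=> // [|s /setD1P[_ sT]]; last exact: tb.
  by rewrite !inE bB andbT; apply: contra_neqN tNa => ba; rewrite (tb a).
Qed.

Hypothesis sym_e : symmetric e.
Variable r : V -> nat.
Hypothesis r_ranking : forall x y z,
  e x y -> e x z -> r x <= r y -> r x <= r z -> y = z.

(** An element a ranked below b has no neighbour in B but b: another one would be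
    ranked no lower than b, hence above a, and a has only one neighbour there.
    So the private neighbour of such an a is b, and no other element of T is
    adjacent to b. *)
Lemma minimal_transversal_lowest (A B T : {set V}) (b : V) :
    b \in B -> {in B, forall x, r b <= r x} -> minimal_transversal A B T ->
  exists2 a, e b a & T :&: [set x in A | e b x] = [set a].
Proof.
move=> bB bmin /minimal_transversalP[TA dom priv].
have below_private a s : a \in T -> s \in T -> e b a -> e b s -> r a < r b -> s = a.
  move=> aT sT ba bs ra; have [b' [b'B b'a ab']] := priv a aT.
  have b'b : b' = b.
    apply: (r_ranking a); rewrite 1?sym_e //; last exact: ltnW.
    exact: leq_trans (ltnW ra) (bmin b' b'B).
  by apply: ab'; rewrite ?b'b.
have [a aT ba] := dom b bB; exists a => //.
apply/setP => s; rewrite !inE; apply/idP/eqP => [/and3P[sT _ bs]|->]; last first.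
  by rewrite aT ba (subsetP TA).
have [ra|ra] := ltnP (r a) (r b); first exact: below_private.
have [rs|rs] := ltnP (r s) (r b); first by apply/esym/below_private.
exact: (r_ranking b).
Qed.

Lemma card_minimal_transversals_le_sum (A B : {set V}) (b : V) :
    b \in B -> {in B, forall x, r b <= r x} ->
  #|minimal_transversals A B| <=
  \sum_(a in [set x in A | e b x])
    #|minimal_transversals (A :\: [set x in A | e b x]) (B :\: [set x | e x a])|.
Proof.
move=> bB bmin; set N := [set x in A | e b x].
pose M' a := minimal_transversals (A :\: N) (B :\: [set x | e x a]).
have sub_cover : minimal_transversals A B \subset
    \bigcup_(a in N) [set a |: T | T in M' a].
  apply/subsetP => T; rewrite inE => minT.
  have [a ba TN] := minimal_transversal_lowest _ _ _ _ bB bmin minT.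
  have /setIP[aT aN] : a \in T :&: N by rewrite TN set11.
  apply/bigcupP; exists a => //; apply/imsetP; exists (T :\ a).
    by rewrite inE; apply: minimal_transversalD1 minT TN.
  by rewrite setD1K.
apply: leq_trans (subset_leq_card sub_cover) _.
elim/big_rec2: _ => [|a m S _ leSm]; first by rewrite cards0.
apply: leq_trans (leq_card_setU _ _) _.
by apply: leq_add leSm; apply: leq_imset_card.
Qed.

End MinimalTransversals.

Lemma leq_cube_exp3 (d : nat) : d ^ 3 <= 3 ^ d.
Proof.
elim: d => // d IHd; case: (ltnP d 3) => [|d_ge3].
  by case: d IHd => [|[|[|]]].
have step : d.+1 ^ 3 <= 3 * d ^ 3 by rewrite !expnS !expn0; nia.
by apply: leq_trans step _; rewrite [3 ^ d.+1]expnS leq_mul2l.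
Qed.

(** The real bound X_a <= 3^(m/3) is cubed to stay in the natural numbers. *)
Lemma sum_cube_leq (I : finType) (N : {set I}) (X : I -> nat) (m : nat) :
  {in N, forall a, X a ^ 3 <= 3 ^ m} -> (\sum_(a in N) X a) ^ 3 <= 3 ^ (m + #|N|).
Proof.
move=> X_le; have [->|[a0 a0N]] := set_0Vmem N; first by rewrite big_set0.
have [|a aN maxX] := @eq_bigmax_cond _ (mem N) X.
  by apply/card_gt0P; exists a0.
have sum_le : \sum_(x in N) X x <= #|N| * X a.
  by rewrite -sum_nat_const -maxX; apply: leq_sum => x xN; apply: leq_bigmax_cond.
apply: (@leq_trans ((#|N| * X a) ^ 3)); first by rewrite leq_exp2r.
by rewrite expnMn addnC expnD leq_mul ?leq_cube_exp3 ?X_le.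
Qed.

Lemma card_minimal_transversals (V : finType) (e : rel V) (A B : {set V}) :
  forest e -> #|minimal_transversals V e A B| ^ 3 <= 3 ^ #|A|.
Proof.
move=> forest_e; have [[sym_e _] _] := forest_e.
have [r r_ranking] := forest_ranking V e forest_e.
move: {2}#|B| (leqnn #|B|) => n; elim: n A B => [|n IHn] A B.
  rewrite leqn0 cards_eq0 => /eqP->.
  suff: minimal_transversals V e A set0 \subset [set set0].
    move/subset_leq_card; rewrite cards1 => le1.
    apply: (@leq_trans (1 ^ 3)); first by rewrite leq_exp2r.
    by rewrite exp1n expn_gt0.
  apply/subsetP => T; rewrite !inE => /minimal_transversalP[_ _ priv].
  by apply/eqP/setP => t; rewrite inE; apply/negP => /priv[b []]; rewrite inE.
have [-> _|[b0 b0B] leBn] := set_0Vmem B; first by apply: IHn; rewrite cards0.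
have [b bB bmin] : exists2 b, b \in B & {in B, forall x, r b <= r x}.
  by case: (arg_minnP r b0B) => b bB bmin; exists b.
have := card_minimal_transversals_le_sum V e sym_e r r_ranking A B b bB bmin.
rewrite -(@leq_exp2r _ _ 3) // => le_sum; apply: leq_trans le_sum _.
set N := [set x in A | e b x].
have -> : #|A| = #|A :\: N| + #|N|.
  have NA : A :&: N = N by apply/setIidPr/subsetP => x; rewrite inE => /andP[].
  by rewrite -(cardsID N A) NA addnC.
apply: sum_cube_leq => a; rewrite inE => /andP[_ ba]; apply: IHn.
rewrite -ltnS; apply: leq_trans leBn; apply/proper_card/properP.
by split; [apply: subsetDl | exists b; rewrite // !inE ba].
Qed.

Lemma min_total_dominating_transversal (V : finType) (e : rel V) (D : {set V}) :
    no_isolated_vertex e -> min_total_dominating e D ->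
  minimal_transversal V e [set: V] [set: V] D.
Proof.
move=> no_iso /andP[/forallP tdD /eqP cardD].
have [_ minD] := total_domination_numberP no_iso.
apply/minimal_transversalP; split; first exact: subsetT.
  by move=> b _; have /exists_inP := tdD b.
move=> t tD; have /forallPn[b] : ~~ total_dominating e (D :\ t).
  apply/negP => /minD; by rewrite -cardD (cardsD1 t D) tD ltnn.
rewrite negb_exists_in => /forall_inP tb.
have only_t s : s \in D -> e b s -> s = t.
  move=> sD bs; apply/eqP; apply: contraTT bs => sNt.
  by apply: tb; rewrite !inE sNt.
have /exists_inP[s sD bs] := tdD b.
by exists b; split; rewrite ?inE // -(only_t s).
Qed.

Local Open Scope ring_scope.
Import Order.TTheory GRing.Theory Num.Theory.

(** The fraction 29/20 separates the cube root of 3 from 1.4865 and keeps the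
    numerals small. *)
Lemma le3_cube_ratio (p q : nat) :
  (0 < q)%N -> (29 * q <= 20 * p)%N -> 3 <= (p%:R / q%:R : rat) ^+ 3.
Proof.
move=> q_gt0; rewrite -(ler_nat rat) !natrM => le_pq.
have pE : p%:R = p%:R / q%:R * q%:R :> rat by rewrite divfK // pnatr_eq0 -lt0n.
move: (p%:R / q%:R) pE => c pE; move: le_pq.
rewrite pE mulrA ler_pM2r ?ltr0n // => le_c.
nra.
Qed.

Lemma le3_cube_constant : 3 <= (14865%:R / 10000%:R : rat) ^+ 3.
Proof. by apply: le3_cube_ratio; vm_compute. Qed.

Theorem theorem4 (V : finType) (e : rel V) :
  (0 < #|V|)%N ->
  forest e ->
  no_isolated_vertex e ->
  (num_min_total_dominating e)%:R <= (14865%:R / 10000%:R : rat) ^+ #|V|.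
Proof.
move=> _ forest_e no_iso.
have cube_le : (num_min_total_dominating e ^ 3 <= 3 ^ #|V|)%N.
  have := card_minimal_transversals V e [set: V] [set: V] forest_e.
  rewrite cardsT; apply: leq_trans; rewrite leq_exp2r //.
  apply/subset_leq_card/subsetP => D; rewrite !inE.
  exact: min_total_dominating_transversal.
have c_ge0 : 0 <= 14865%:R / 10000%:R :> rat by rewrite divr_ge0 ?ler0n.
(* Abstracting the constant keeps its large numerals away from unification. *)
move: (_ / _) c_ge0 le3_cube_constant => c c_ge0 le3_cube_c.
rewrite -(@ler_pXn2r _ 3) ?nnegrE ?ler0n ?exprn_ge0 //.
rewrite -natrX -exprM mulnC exprM.
apply: (@le_trans _ _ (3 ^ #|V|)%N%:R); first by rewrite ler_nat.
by rewrite natrX lerXn2r ?nnegrE ?exprn_ge0 ?ler0n.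
Qed.
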